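(* Let $d\ge 1$, let $\mu\in\mathbb{R}^d$, and let $\Sigma\in\mathbb{R}^{d\times d}$ be a symmetric positive definite covariance matrix; write $\mathcal{D}=\mathcal{N}(\mu,\Sigma)$. Fix initial parameters $\theta_0\in\mathbb{R}^d$, a vector $v\in\mathbb{R}^d$, a learning rate $0<\eta<1/2$, and an integer $k\ge 1$. Define $$\theta_0^+=\theta_0-2\eta(\theta_0-v),\qquad \theta_0^-=\theta_0-2\eta(\theta_0+v),$$ and for $i=1,\dots,k$ draw $x_i^+,x_i^-$ independently from $\mathcal{D}$ (all draws mutually independent) and set $$\theta_i^+=\theta_{i-1}^+-2\eta(\theta_{i-1}^+-x_i^+),\qquad \theta_i^-=\theta_{i-1}^--2\eta(\theta_{i-1}^--x_i^-).$$ Then for every order $\alpha>1$, the R\'enyi divergence of order $\alpha$ between the distribution of $\theta_k^+$ and the distribution of $\theta_k^-$ is at most $\frac{2\alpha}{k}\,v^\top\Sigma^{-1}v$.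
   Context: This models mean estimation by per-example stochastic gradient descent on the squared $\ell_2$ loss $\|\theta-x\|^2$ (gradient $2(\theta-x)$), where a single injected example ($+v$ in one run, $-v$ in the other) is used in the very first step and all subsequent examples are fresh random samples from $\mathcal{D}$. The R\'enyi divergence of order $\alpha>1$ between distributions $P,Q$ with densities $p,q$ is $D_\alpha(P\|Q)=\frac{1}{\alpha-1}\log\int p(x)^\alpha q(x)^{1-\alpha}\,dx$. *)

(* Defs.v *)
From HB Require Import structures.
From mathcomp Require Import all_boot all_order all_algebra.
From mathcomp Require Import all_classical all_reals all_analysis.
Set Implicit Arguments. Unset Strict Implicit. Unset Printing Implicit Defensive.
Import Order.TTheory GRing.Theory Num.Theory.
Local Open Scope classical_set_scope.
Local Open Scope ring_scope.

(* Vectors of R^n are represented, on the measure-theoretic side, as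
   n.-tuple R, which carries the product (Borel) sigma-algebra
   [measurable_tuple] of mathcomp-analysis; on the algebraic side as
   column vectors 'cV[R]_n. *)
Definition vec_of {R : realType} {n : nat} (t : n.-tuple R) : 'cV[R]_n :=
  \col_i tnth t i.
Definition tuple_of_cV {R : realType} {n : nat} (c : 'cV[R]_n) : n.-tuple R :=
  mktuple (fun i => c i ord0).

(* Integral w.r.t. Lebesgue measure on R^n, as the iterated Lebesgue
   integral (equal to the product-Lebesgue integral for nonnegative
   measurable integrands by Tonelli). *)
Fixpoint intRn (R : realType) (n : nat) : (n.-tuple R -> \bar R) -> \bar R :=
  match n with
  | 0 => fun f => f [tuple]
  | n'.+1 => fun f =>
      (\int[@lebesgue_measure R]_(x in [set: R]) @intRn R n' (fun t => f (cons_tuple x t)))%E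
  end.
Arguments intRn {R n}.

Definition is_density {R : realType} {n : nat}
    (law : set (n.-tuple R) -> \bar R) (p : n.-tuple R -> R) : Prop :=
  [/\ (forall x, 0 <= p x), measurable_fun setT p &
      forall A : set (n.-tuple R), measurable A ->
        law A = intRn (fun x => (\1_A x * p x)%:E)].

Definition gauss_pdf {R : realType} {n : nat} (m : 'cV[R]_n) (S : 'M[R]_n)
    (x : n.-tuple R) : R :=
  let y := vec_of x - m in
  expR (- (1/2) * ((y^T *m invmx S *m y) ord0 ord0))
    / Num.sqrt ((2 * pi) ^+ n * \det S).

Definition sym_posdef {R : realType} {n : nat} (S : 'M[R]_n) : Prop :=
  S^T = S /\ forall x : 'cV[R]_n, x != 0 -> 0 < (x^T *m S *m x) ord0 ord0.

Definition renyi_div {R : realType} {n : nat} (alpha : R)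
    (p q : n.-tuple R -> R) : \bar R :=
  match intRn (fun x => (p x `^ alpha * q x `^ (1 - alpha))%:E) with
  | r%:E => ((alpha - 1)^-1 * ln r)%:E
  | +oo%E => +oo%E
  | -oo%E => -oo%E
  end.

(* The SGD iterates: theta b 0 = theta0 - 2 eta (theta0 - s_b v) with s_true = +1,
   s_false = -1, and theta b (i+1) = theta b i - 2 eta (theta b i - x_{i+1}^b),
   where the sample x_{i+1}^b is X b i. *)
Fixpoint sgd_theta (R : realType) (T : Type) (n : nat) (eta : R)
    (theta0 v : 'cV[R]_n) (X : bool -> nat -> T -> n.-tuple R)
    (b : bool) (i : nat) (w : T) : 'cV[R]_n :=
  match i with
  | 0 => theta0 - (2 * eta) *: (theta0 - (if b then v else - v))
  | i'.+1 => let th := @sgd_theta R T n eta theta0 v X b i' w in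
             th - (2 * eta) *: (th - vec_of (X b i' w))
  end.
Arguments sgd_theta {R T n}.

(* Main.v *)
(* Each iterate is an affine image of independent Gaussian samples, so theta_k^+
   and theta_k^- are Gaussian with the same covariance s_k Sigma, where
   s_{i+1} = (2 eta)^2 + c^2 s_i and c = 1 - 2 eta, and with means differing by
   4 eta c^k v. Densities being unique almost everywhere, the Renyi divergence is
   exactly alpha / (2 s_k) times the Mahalanobis square of 4 eta c^k v, and
   s_k >= k (2 eta)^2 c^(2k) because c^2 <= 1.
   The law of theta_{i+1} is obtained from that of theta_i by Tonelli and
   completing the square, all covariances being multiples of Sigma; normalising
   constants are read off from total masses, so no determinant is evaluated. *)
Require Import Defs.
From HB Require Import structures.
From mathcomp Require Import all_boot all_order all_algebra.
From mathcomp Require Import all_classical all_reals all_analysis.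
From mathcomp Require Import measurable_realfun ring lra.
Set Implicit Arguments. Unset Strict Implicit. Unset Printing Implicit Defensive.
Import Order.TTheory GRing.Theory Num.Theory.
Local Open Scope classical_set_scope.
Local Open Scope ring_scope.

(** * Lebesgue measure on R^n *)

Definition image_measure d d' (T1 : measurableType d) (T2 : measurableType d')
    (R : realFieldType) (m : {measure set T1 -> \bar R}) (f : T1 -> T2)
    (mf : measurable_fun setT f) : {measure set T2 -> \bar R} :=
  measure_function_pushforward__canonical__measure_function_Measure m mf.

Section sigma_finite_measure_of.
Context d (T : measurableType d) (R : realType) (m : {measure set T -> \bar R}).
Hypothesis sm : sigma_finite setT m.

(** Tonelli and Radon-Nikodym are applied to bundled sigma-finite measures; this alias takes the
    proof of sigma-finiteness as an argument, so that the instance can be attached to any such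
    [m]. *)
Definition sigma_finite_copy & sigma_finite setT m : set T -> \bar R := m.

HB.instance Definition _ := Measure.copy (sigma_finite_copy sm) m.
HB.instance Definition _ :=
  @Measure_isSigmaFinite.Build _ _ _ (sigma_finite_copy sm) sm.

Definition sigma_finite_measure_of : {sigma_finite_measure set T -> \bar R} :=
  sigma_finite_copy sm.

End sigma_finite_measure_of.

(** Both exhaustions are taken nondecreasing, so the diagonal rectangles already cover: a point of
    [F i] times [G j] lies in the rectangle of index [maxn i j]. *)
Lemma sigma_finite_prod d1 d2 (T1 : measurableType d1) (T2 : measurableType d2)
    (R : realType) (m1 : {sigma_finite_measure set T1 -> \bar R})
    (m2 : {sigma_finite_measure set T2 -> \bar R}) :
  sigma_finite setT (m1 \x m2)%E.
Proof.
have /sigma_finiteP[F [TF ndF Foo]] := sigma_finiteT m1.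
have /sigma_finiteP[G [TG ndG Goo]] := sigma_finiteT m2.
exists (fun n => F n `*` G n).
  apply/esym/seteqP; split => // -[x y] _.
  have [i _ Fix] : (\bigcup_i F i) x by rewrite -TF.
  have [j _ Gjy] : (\bigcup_i G i) y by rewrite -TG.
  exists (maxn i j) => //; split => /=.
    by move/subsetPset: (ndF _ _ (leq_maxl i j)); exact.
  by move/subsetPset: (ndG _ _ (leq_maxr i j)); exact.
move=> n; have [[mF Fn] [mG Gn]] := (Foo n, Goo n).
by split; [exact: measurableX|rewrite product_measure1E// lte_mul_pinfty// ge0_fin_numE].
Qed.

Section lebesgue_Rn.
Context (R : realType).

(* [R] and [measurableTypeR R] have the same measurable sets but carry different
   displays, so Lebesgue measure is transported along the identity. *)
Lemma measurable_idR : measurable_fun setT (id : measurableTypeR R -> R).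
Proof. by move=> _ A mA; rewrite setTI. Qed.

Let lebI : {measure set R -> \bar R} :=
  @image_measure _ _ (measurableTypeR R) R R (@lebesgue_measure R) id measurable_idR.

Let lebI_sigma_finite : sigma_finite setT lebI.
Proof.
have [F TF Foo] := sigma_finiteT (@lebesgue_measure R).
by exists F => // k; have [] := Foo k.
Qed.

Definition lebesgue_R : {sigma_finite_measure set R -> \bar R} :=
  sigma_finite_measure_of lebI_sigma_finite.

Lemma integral_lebesgue_R (f : R -> \bar R) : measurable_fun setT f ->
  (forall x, 0 <= f x)%E ->
  (\int[lebesgue_R]_x f x = \int[lebesgue_measure]_(x in [set: R]) f x)%E.
Proof.
move=> mf f0.
have f0' : {in [set: R], forall y, 0 <= f y}%E by move=> y _.
exact: (@ge0_integral_pushforward _ _ (measurableTypeR R) R R id measurable_idR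
    (@lebesgue_measure R) setT f measurableT mf f0').
Qed.

Lemma measurable_consX n :
  measurable_fun [set: R * n.-tuple R] (fun z => cons_tuple z.1 z.2).
Proof. exact: (@measurable_cons _ _ (R * n.-tuple R)%type R fst n snd). Qed.

(** Turns the iterated integral into an integral against one sigma-finite measure, which opens the
    way to Tonelli and almost-everywhere arguments. In dimension [n.+1] this measure is the image of
    a product under [cons_tuple]. *)
Lemma lebesgue_Rn_exists n :
  exists m : {sigma_finite_measure set (n.-tuple R) -> \bar R},
    forall f : n.-tuple R -> \bar R, measurable_fun [set: n.-tuple R] f ->
      (forall x, 0 <= f x)%E -> intRn f = (\int[m]_x f x)%E.
Proof.
elim: n => [|n [m mE]].
  exists (@dirac _ _ [tuple] R) => f mf f0 /=.
  by rewrite integral_dirac// diracT mul1e.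
pose phi := fun z : R * n.-tuple R => cons_tuple z.1 z.2.
pose M : {measure set (n.+1.-tuple R) -> \bar R} :=
  @image_measure _ _ _ _ _ (lebesgue_R \x m)%E phi (@measurable_consX n).
have sM : sigma_finite setT M.
  have [F TF Foo] := sigma_finite_prod lebesgue_R m.
  (* [phi] is a bijection with measurable inverse [psi], so the images of an exhaustion are
     measurable sets of the same mass that cover the space. *)
  exists (fun k => phi @` (F k)).
    rewrite -image_bigcup -TF; apply/esym/seteqP; split => // t _.
    by exists (thead t, [tuple of behead t]) => //; rewrite [RHS]tuple_eta; exact: val_inj.
  move=> k; have [mF Fk] := Foo k.
  have phiK : phi @^-1` (phi @` F k) = F k.
    apply/seteqP; split => [[x t] [[y s] Fys]|z Fz]; last by exists z.
    by move=> /(congr1 val)/= [<- /val_inj <-].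
  split; last by rewrite -[X in (X < _)%E]/((lebesgue_R \x m)%E (phi @^-1` (phi @` F k))) phiK.
  pose psi := fun t : n.+1.-tuple R => (thead t, [tuple of behead t]).
  have -> : phi @` F k = psi @^-1` F k.
    apply/seteqP; split => [_ [[x s] Fxs <-]|t Ft].
      rewrite /psi/= (_ : (_, _) = (x, s))//; congr (_, _); exact/val_inj.
    by exists (psi t) => //; rewrite [RHS]tuple_eta; exact: val_inj.
  rewrite -[X in measurable X]setTI.
  have : measurable_fun setT psi.
    apply/measurable_fun_pairP; split; last exact: measurable_behead.
    exact: (@measurable_tnth _ _ n.+1 ord0).
  exact.
exists (sigma_finite_measure_of sM) => f mf f0.
transitivity (\int[(lebesgue_R \x m)%E]_(z in phi @^-1` setT) (f \o phi) z)%E; last first.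
  apply/esym.
  have f0' : {in [set: n.+1.-tuple R], forall y, 0 <= f y}%E by move=> y _.
  have H := @ge0_integral_pushforward _ _ _ _ R phi (@measurable_consX n)
    (lebesgue_R \x m)%E setT f measurableT mf f0'.
  exact: H.
have mfphi : measurable_fun setT (f \o phi).
  exact: (measurableT_comp mf (@measurable_consX n)).
rewrite preimage_setT (fubini_tonelli1 (f \o phi) mfphi); last by move=> z; exact: f0.
have mF := measurable_fun_fubini_tonelli_F (m2 := m) (f \o phi) mfphi
  (fun=> f0 _).
have F0 x : (0 <= fubini_F m (f \o phi) x)%E.
  by apply: integral_ge0 => y _; exact: f0.
rewrite (integral_lebesgue_R mF F0).
apply: eq_integral => x _.
have mfx : measurable_fun setT (fun t => f (cons_tuple x t)).
  apply: measurableT_comp => //.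
  exact: (@measurable_cons _ _ _ R (cst x) n id).
exact: (mE _ mfx (fun=> f0 _)).
Qed.

Definition lebesgue_Rn n := sval (cid (lebesgue_Rn_exists n)).

Lemma intRnE n (f : n.-tuple R -> \bar R) : measurable_fun [set: n.-tuple R] f ->
  (forall x, 0 <= f x)%E -> intRn f = (\int[lebesgue_Rn n]_x f x)%E.
Proof. exact: (svalP (cid (lebesgue_Rn_exists n))). Qed.

End lebesgue_Rn.

(** * Affine change of variables *)

Section affine_change_of_variables.
Context (R : realType).

Let affR (a u : R) : measurableTypeR R -> measurableTypeR R := fun x => a * x + u.

Let measurable_affR a u : measurable_fun setT (affR a u).
Proof. by apply: measurable_funD => //; apply: measurable_funM. Qed.

(** The image measure rescaled by [a] agrees with Lebesgue measure on half-open intervals, hence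
    everywhere by uniqueness. *)
Lemma lebesgue_measure_affine (a u : R) (A : set (measurableTypeR R)) : 0 < a ->
  measurable A -> lebesgue_measure A =
  (a%:E * lebesgue_measure [set x | A (a * x + u)%R])%E.
Proof.
move=> a0 mA.
pose an : {nonneg R} := NngNum (ltW a0).
pose M : {measure set (measurableTypeR R) -> \bar R} :=
  mscale an (@image_measure _ _ _ _ _ (@lebesgue_measure R) _ (measurable_affR a u)).
rewrite (@lebesgue_measure_unique _ M)// => _ [[b c]] _ <-/=.
rewrite /mscale/= /pushforward.
have -> : affR a u @^-1` `]b, c] = `](b - u) / a, (c - u) / a]%classic.
  apply/seteqP; split => x /=; rewrite !in_itv/= /affR ltr_pdivrMr// ler_pdivlMr//.
    by move=> /andP[? ?]; apply/andP; split; lra.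
  by move=> /andP[? ?]; apply/andP; split; lra.
rewrite !lebesgue_measure_itv/= !lte_fin ltr_pM2r ?invr_gt0// ltrD2r.
case: ifP => _; last by rewrite mule0.
rewrite -!EFinB -EFinM; congr EFin.
by field; rewrite gt_eqF.
Qed.

Lemma integral_affine (a u : R) (f : R -> \bar R) : 0 < a ->
  measurable_fun setT f -> (forall x, 0 <= f x)%E ->
  (\int[lebesgue_measure]_(x in [set: R]) f x =
   a%:E * \int[lebesgue_measure]_(x in [set: R]) f (a * x + u)%R)%E.
Proof.
move=> a0 mf f0.
pose an : {nonneg R} := NngNum (ltW a0).
pose I := @image_measure _ _ _ _ _ (@lebesgue_measure R) _ (measurable_affR a u).
have mf' : measurable_fun [set: measurableTypeR R] f by [].
have f0' : {in [set: measurableTypeR R], forall y, 0 <= f y}%E by move=> y _.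
transitivity (\int[mscale an I]_(x in setT) f x)%E.
  by apply: eq_measure_integral => A mA _; exact: lebesgue_measure_affine.
rewrite ge0_integral_mscale//; congr (_ * _)%E.
exact: (@ge0_integral_pushforward _ _ _ _ R _ (measurable_affR a u)
    (@lebesgue_measure R) setT f measurableT mf' f0').
Qed.

Definition affine_tuple n (a : R) (u t : n.-tuple R) : n.-tuple R :=
  [tuple a * tnth t i + tnth u i | i < n].

Lemma measurable_affine_tuple n (a : R) (u : n.-tuple R) :
  measurable_fun setT (affine_tuple a u).
Proof.
apply/measurable_fun_tnthP => i.
rewrite (_ : _ \o _ = (fun t => a * tnth t i + tnth u i)); last first.
  by apply/funext => t /=; rewrite tnth_mktuple.
by apply: measurable_funD => //; apply: measurable_funM => //; exact: measurable_tnth.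
Qed.

Lemma affine_tuple_cons n (a x : R) (u : n.+1.-tuple R) (t : n.-tuple R) :
  affine_tuple a u (cons_tuple x t) =
  cons_tuple (a * x + thead u) (affine_tuple a (behead_tuple u) t).
Proof.
apply: eq_from_tnth => i; rewrite tnth_mktuple.
case: (unliftP ord0 i) => [j|] ->; last by rewrite !tnth0.
by rewrite !tnthS tnth_mktuple tnth_behead; congr (_ + tnth _ _); apply: val_inj; rewrite /= inordK ?ltnS.
Qed.

Lemma measurable_intRn_cons n (f : n.+1.-tuple R -> \bar R) :
  measurable_fun setT f -> (forall x, 0 <= f x)%E ->
  measurable_fun setT (fun x => intRn (fun t => f (cons_tuple x t))).
Proof.
move=> mf f0; pose phi := fun z : R * n.-tuple R => cons_tuple z.1 z.2.
have mfphi : measurable_fun setT (f \o phi).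
  exact: (measurableT_comp mf (@measurable_consX R n)).
have := measurable_fun_fubini_tonelli_F (m2 := lebesgue_Rn R n) (f \o phi) mfphi
  (fun=> f0 _).
congr (measurable_fun _ _); apply/funext => x; apply/esym/intRnE => //.
apply: measurableT_comp => //.
exact: (@measurable_cons _ _ _ R (cst x) n id).
Qed.

Lemma intRn_ge0 n (f : n.-tuple R -> \bar R) :
  (forall x, 0 <= f x)%E -> (0 <= intRn f)%E.
Proof.
elim: n f => [|n IH] f f0 //=.
by apply: integral_ge0 => x _; exact: IH.
Qed.

(** Induction on the dimension: each coordinate contributes one factor [a] through the
    one-dimensional substitution. *)
Lemma intRn_affine n (a : R) (u : n.-tuple R) (f : n.-tuple R -> \bar R) :
  0 < a -> measurable_fun setT f -> (forall x, 0 <= f x)%E ->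
  intRn f = ((a ^+ n)%:E * intRn (fun t => f (affine_tuple a u t)))%E.
Proof.
move=> a0; elim: n u f => [|n IH] u f mf f0.
  by rewrite expr0 mul1e /=; congr f; rewrite tuple0 [RHS]tuple0.
have mfx x : measurable_fun setT (fun t => f (cons_tuple x t)).
  apply: measurableT_comp => //.
  exact: (@measurable_cons _ _ _ R (cst x) n id).
pose g x := intRn (fun t => f (cons_tuple x (affine_tuple a (behead_tuple u) t))).
have gE x : intRn (fun t => f (cons_tuple x t)) = ((a ^+ n)%:E * g x)%E.
  by rewrite (IH (behead_tuple u)).
have g0 x : (0 <= g x)%E by apply: intRn_ge0.
have mg : measurable_fun setT g.
  (* Solving [gE] for [g] reduces its measurability to that of the section integrals of [f]. *)
  rewrite (_ : g = (fun x => (a ^- n)%:E * intRn (fun t => f (cons_tuple x t)))%E).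
    by apply: measurable_funeM; exact: measurable_intRn_cons.
  apply/funext => x; rewrite gE muleA -EFinM mulVf ?mul1e//.
  by rewrite expf_neq0// gt_eqF.
rewrite [LHS]/=.
transitivity (\int[lebesgue_measure]_(x in [set: R]) ((a ^+ n)%:E * g x))%E.
  by apply: eq_integral => x _; exact: gE.
rewrite ge0_integralZl//; last by rewrite lee_fin exprn_ge0// ltW.
rewrite (integral_affine (thead u) a0 mg g0) muleA -EFinM -exprSr.
congr (_ * _)%E; apply: eq_integral => x _.
by congr intRn; apply/funext => t; rewrite affine_tuple_cons.
Qed.

End affine_change_of_variables.

(** * Densities and the Mahalanobis form *)

Section densities.
Context d (T : measurableType d) (R : realType).
Variable m : {sigma_finite_measure set T -> \bar R}.

(** Counterpart of the integral clause of [is_density], with one reference measure in place of the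
    iterated integral. *)
Definition has_density (law : set T -> \bar R) (g : T -> R) : Prop :=
  forall A, measurable A -> law A = (\int[m]_x (\1_A x * g x)%:E)%E.

Lemma integral_indicM (A : set T) (g : T -> R) :
  (\int[m]_(x in A) (g x)%:E = \int[m]_x (\1_A x * g x)%:E)%E.
Proof.
rewrite integral_mkcond; apply: eq_integral => x _.
by rewrite patchE indicE; case: ifP => _; rewrite ?mul1r ?mul0r.
Qed.

Lemma has_density_integrable (law : set T -> \bar R) (g : T -> R) :
  measurable_fun setT g -> (forall x, 0 <= g x) -> (law setT < +oo)%E ->
  has_density law g -> m.-integrable setT (EFin \o g).
Proof.
move=> mg g0 fin H; apply/integrableP; split; first exact/measurable_EFinP.
move: fin; rewrite H// -integral_indicM; congr (_ < _)%E.
by apply: eq_integral => x _ /=; rewrite ger0_norm.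
Qed.

(** Both densities have the same integral over every measurable set. This lets arbitrary densities
    of the final laws be replaced by Gaussian kernels. *)
Lemma has_density_ae_eq (law : set T -> \bar R) (g h : T -> R) :
  measurable_fun setT g -> measurable_fun setT h ->
  (forall x, 0 <= g x) -> (law setT < +oo)%E ->
  has_density law g -> has_density law h ->
  ae_eq m setT (EFin \o g) (EFin \o h).
Proof.
move=> mg mh g0 fin Hg Hh; apply: integral_ae_eq => //.
- exact: has_density_integrable Hg.
- exact/measurable_EFinP.
- by move=> A _ mA; rewrite (integral_indicM A g) (integral_indicM A h) -Hg// -Hh.
Qed.

(** The density makes [nu] absolutely continuous, and [g] coincides almost everywhere with the
    Radon-Nikodym derivative because their integrals over measurable sets agree. *)
Lemma integral_has_density (nu : {finite_measure set T -> \bar R}) (g : T -> R)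
    (f : T -> \bar R) :
  measurable_fun setT g -> (forall x, 0 <= g x) -> has_density nu g ->
  measurable_fun setT f -> (forall x, 0 <= f x)%E ->
  (\int[nu]_x f x = \int[m]_x (f x * (g x)%:E))%E.
Proof.
move=> mg g0 H mf f0.
have dom : nu `<< m.
  apply/null_content_dominatesP => A mA mA0; rewrite H// -integral_indicM.
  by apply: null_set_integral => //; apply: measurable_funTS; exact/measurable_EFinP.
rewrite -(Radon_Nikodym_SigmaFinite.change_of_variables dom)//.
have mRN := measurable_int _ (Radon_Nikodym_SigmaFinite.f_integrable dom).
apply: ge0_ae_eq_integral => //.
- exact: emeasurable_funM.
- by apply: emeasurable_funM => //; exact/measurable_EFinP.
- by move=> x _; rewrite mule_ge0// Radon_Nikodym_SigmaFinite.f_ge0.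
- by move=> x _; rewrite mule_ge0// lee_fin.
- apply: (@ae_eqe_mul2l _ _ _ _ _ _ (EFin \o g)); apply: integral_ae_eq => //.
  + exact: Radon_Nikodym_SigmaFinite.f_integrable.
  + exact/measurable_EFinP.
  + move=> A _ mA; rewrite -Radon_Nikodym_SigmaFinite.f_integral// H//.
    by rewrite -integral_indicM.
Qed.

End densities.

(** * Quadratic form of the inverse covariance: polarisation and completing the square *)

Section mahalanobis.
Context (R : realType) (d : nat) (S : 'M[R]_d).
Hypothesis Spd : sym_posdef S.

Definition mahal (y : 'cV[R]_d) : R := (y^T *m invmx S *m y) ord0 ord0.
(** Polar form of [mahal]; with it, completing the square becomes an identity between real
    numbers. *)
Definition mahal2 (x y : 'cV[R]_d) : R := (x^T *m invmx S *m y) ord0 ord0.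

(** A nonzero row of the left kernel of [S], transposed, would be a nonzero [x] with
    [x^T *m S *m x = 0]. *)
Lemma sym_posdef_unit : S \in unitmx.
Proof.
have [ST Spos] := Spd.
rewrite -row_free_unit -kermx_eq0; apply/eqP/matrixP => i j; rewrite [RHS]mxE.
apply/eqP; apply: contraT => kij.
pose x := (row i (kermx S))^T.
have x0 : x != 0.
  apply: contra kij => /eqP/matrixP/(_ j ord0).
  by rewrite !mxE => ->.
have := Spos _ x0.
rewrite /x trmxK -row_mul mulmx_ker row0 mul0mx mxE.
by rewrite ltxx.
Qed.

Lemma mahal2C x y : mahal2 x y = mahal2 y x.
Proof.
rewrite /mahal2 -[in LHS](trmxK y).
have -> : (x^T *m invmx S *m y^T^T) ord0 ord0 = (x^T *m invmx S *m y^T^T)^T ord0 ord0.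
  by rewrite [RHS]mxE.
by rewrite !trmx_mul !trmxK trmx_inv (proj1 Spd) mulmxA.
Qed.

Lemma mahalD x y : mahal (x + y) = mahal x + 2 * mahal2 x y + mahal y.
Proof.
have -> : mahal (x + y) = mahal x + mahal2 x y + (mahal2 y x + mahal y).
  by rewrite /mahal /mahal2 [(x + y)^T]linearD/= !mulmxDl !mulmxDr !mxE -!addrA.
by rewrite (mahal2C y x); ring.
Qed.

Lemma mahalZ a x : mahal (a *: x) = a ^+ 2 * mahal x.
Proof. by rewrite /mahal [(a *: x)^T]linearZ/= -!scalemxAl -scalemxAr !mxE expr2 mulrA. Qed.

Lemma mahal2Zr a x y : mahal2 x (a *: y) = a * mahal2 x y.
Proof. by rewrite /mahal2 -scalemxAr mxE. Qed.

(** With [z = invmx S *m x], the value is [z^T *m S *m z]. *)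
Lemma mahal_ge0 x : 0 <= mahal x.
Proof.
have [ST Spos] := Spd; have Su := sym_posdef_unit.
have -> : mahal x = ((invmx S *m x)^T *m S *m (invmx S *m x)) ord0 ord0.
  by rewrite /mahal trmx_mul trmx_inv ST mulmxA mulmxKV.
have [->|/Spos/ltW//] := eqVneq (invmx S *m x) 0.
by rewrite trmx0 !mul0mx mxE.
Qed.

(* Completing the square in the convolution of N(m, s S) with N(b, t S). *)
Lemma mahal_conv (s t c : R) (w z : 'cV[R]_d) : 0 < s -> 0 < t ->
  s^-1 * mahal w + t^-1 * mahal (z - c *: w) =
  (s * t / (t + c ^+ 2 * s))^-1 * mahal (w - (c * s / (t + c ^+ 2 * s)) *: z)
  + (t + c ^+ 2 * s)^-1 * mahal z.
Proof.
move=> s0 t0.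
have D0 : 0 < t + c ^+ 2 * s.
  by rewrite (lt_le_trans t0)// lerDl mulr_ge0 ?sqr_ge0// ltW.
have NZ a (x : 'cV[R]_d) : - (a *: x) = (- a) *: x by rewrite scaleNr.
rewrite !NZ !mahalD !mahalZ !mahal2Zr (mahal2C z w).
by field; rewrite !gt_eqF.
Qed.

(** Completing the square in the exponent of [p^a q^(1-a)] for two Gaussians of equal covariance:
    [x] is the offset from the first mean and [y] the difference of the means. *)
Lemma mahal_renyi (a : R) (x y : 'cV[R]_d) :
  a * mahal x + (1 - a) * mahal (x + y) =
  mahal (x + (1 - a) *: y) + a * (1 - a) * mahal y.
Proof. by rewrite !mahalD !mahalZ !mahal2Zr; ring. Qed.

Lemma measurable_mahal dT (T : measurableType dT) (h : T -> 'cV[R]_d) :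
  (forall i, measurable_fun setT (fun x => h x i ord0)) ->
  measurable_fun setT (fun x => mahal (h x)).
Proof.
move=> mh.
rewrite (_ : (fun x => _) = (fun x =>
    \sum_j (\sum_i h x i ord0 * invmx S i j) * h x j ord0)); last first.
  apply/funext => x; rewrite /mahal mxE; apply: eq_bigr => j _.
  by rewrite mxE; congr (_ * _); apply: eq_bigr => i _; rewrite mxE.
apply: measurable_sum => j; apply: measurable_funM => //.
by apply: measurable_sum => i; apply: measurable_funM.
Qed.

End mahalanobis.

(** * Gaussian kernels *)

Lemma integral_EFinZl dT (T : measurableType dT) (R : realType)
    (m : {measure set T -> \bar R}) (K : R) (f : T -> R) :
  measurable_fun setT f -> (forall x, 0 <= f x) -> 0 <= K ->
  (\int[m]_x (K * f x)%:E = K%:E * \int[m]_x (f x)%:E)%E.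
Proof.
move=> mf f0 K0; rewrite -ge0_integralZl_EFin//; last exact/measurable_EFinP.
by move=> x _; rewrite lee_fin.
Qed.

Section gaussian_kernel.
Context (R : realType) (d : nat) (S : 'M[R]_d).
Hypothesis Spd : sym_posdef S.

(** Density of N(m, s S) up to its constant. All covariances are multiples of [S], so a real [s]
    encodes them, and the constant is carried outside. *)
Definition gker (m : 'cV[R]_d) (s : R) (x : d.-tuple R) : R :=
  expR (- ((2 * s)^-1 * mahal S (vec_of x - m))).

Lemma gker_ge0 m s x : 0 <= gker m s x. Proof. exact: expR_ge0. Qed.

Lemma measurable_vec_of i : measurable_fun setT (fun x : d.-tuple R => vec_of x i ord0).
Proof.
rewrite (_ : (fun x => _) = (fun x => tnth x i)); first exact: measurable_tnth.
by apply/funext => x; rewrite mxE.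
Qed.

Lemma measurable_gker2 (c s : R) (b : 'cV[R]_d) :
  measurable_fun setT
    (fun z : d.-tuple R * d.-tuple R => gker (c *: vec_of z.1 + b) s z.2).
Proof.
apply: measurableT_comp => //; apply: measurableT_comp => //.
apply: measurable_funM => //; apply: measurable_mahal => i.
rewrite (_ : (fun z => _) = (fun z : d.-tuple R * d.-tuple R =>
    vec_of z.2 i ord0 - (c * vec_of z.1 i ord0 + b i ord0))); last first.
  by apply/funext => z; rewrite !mxE.
apply: measurable_funB.
  exact: (measurableT_comp (measurable_vec_of i) measurable_snd).
apply: measurable_funD => //; apply: measurable_funM => //.
exact: (measurableT_comp (measurable_vec_of i) measurable_fst).
Qed.

Lemma measurable_gker m s : measurable_fun setT (gker m s).
Proof.
apply: measurableT_comp => //; apply: measurableT_comp => //.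
apply: measurable_funM => //; apply: measurable_mahal => i.
rewrite (_ : (fun z => _) = (fun z : d.-tuple R => vec_of z i ord0 - m i ord0)).
  by apply: measurable_funB => //; exact: measurable_vec_of.
by apply/funext => z; rewrite !mxE.
Qed.

Lemma vec_of_affine a u x :
  vec_of (affine_tuple a u x) = a *: vec_of x + vec_of u :> 'cV[R]_d.
Proof. by apply/matrixP => i j; rewrite !mxE tnth_mktuple. Qed.

Lemma vec_ofK : cancel (@vec_of R d) (@tuple_of_cV R d).
Proof. by move=> x; apply: eq_from_tnth => i; rewrite tnth_mktuple mxE. Qed.

Lemma tuple_of_cVK : cancel (@tuple_of_cV R d) (@vec_of R d).
Proof.
by move=> x; apply/matrixP => i j; rewrite mxE tnth_mktuple (ord1 j).
Qed.

Lemma gker_affine (a s : R) m u x : 0 < a ->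
  gker (a *: m + vec_of u) (a ^+ 2 * s) (affine_tuple a u x) = gker m s x.
Proof.
move=> a0; rewrite /gker vec_of_affine.
rewrite (_ : a *: vec_of x + vec_of u - _ = a *: (vec_of x - m)); last first.
  by rewrite opprD addrACA subrr addr0 scalerBr.
congr (expR (- _)); rewrite mahalZ !invfM.
by move: (s^-1) (mahal _ _) => si q; field; rewrite gt_eqF.
Qed.

Lemma lebesgue_Rn_affine (a : R) (u : d.-tuple R) (f : d.-tuple R -> R) :
  0 < a -> measurable_fun setT f -> (forall x, 0 <= f x) ->
  (\int[lebesgue_Rn R d]_x (f (affine_tuple a u x))%:E =
   (a ^- d)%:E * \int[lebesgue_Rn R d]_x (f x)%:E)%E.
Proof.
move=> a0 mf f0.
have mEf : measurable_fun setT (EFin \o f) by exact/measurable_EFinP.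
have Ef0 x : (0 <= (EFin \o f) x)%E by rewrite lee_fin.
rewrite -(intRnE mEf Ef0) (intRn_affine u a0 mEf Ef0) muleA -EFinM mulVf ?mul1e.
  rewrite intRnE//; apply: (measurableT_comp mEf).
  exact: measurable_affine_tuple.
by rewrite expf_neq0// gt_eqF.
Qed.

(** The substitution [x] to [sqrt s * x + m] reduces every kernel to the standard one, so the mass
    does not depend on the centre. *)
Lemma integral_gker m s : 0 < s ->
  (\int[lebesgue_Rn R d]_x (gker m s x)%:E =
   (Num.sqrt s ^+ d)%:E * \int[lebesgue_Rn R d]_x (gker 0 1 x)%:E)%E.
Proof.
move=> s0; have a0 : 0 < Num.sqrt s by rewrite sqrtr_gt0.
transitivity ((Num.sqrt s ^+ d)%:E * \int[lebesgue_Rn R d]_x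
    (gker m s (affine_tuple (Num.sqrt s) (tuple_of_cV m) x))%:E)%E.
  rewrite (lebesgue_Rn_affine _ a0 (measurable_gker m s) (gker_ge0 m s)).
  by rewrite muleA -EFinM mulfV ?mul1e// expf_neq0// gt_eqF.
apply: (congr1 (mule _)); apply: eq_integral => x _.
rewrite -(@gker_affine (Num.sqrt s) 1 0 (tuple_of_cV m))// scaler0 add0r.
by rewrite tuple_of_cVK mulr1 sqr_sqrtr// ltW.
Qed.

(** The update [c theta + e x], written as an affine map of the sample [z.2] so that the change of
    variables applies for a fixed state [z.1]. *)
Definition sgd_step (c e : R) (z : d.-tuple R * d.-tuple R) : d.-tuple R :=
  affine_tuple e (tuple_of_cV (c *: vec_of z.1)) z.2.

Section normalized.
Variables (mu : 'cV[R]_d) (kappa : R).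
Hypothesis kappa0 : 0 <= kappa.
Hypothesis kappa1 : (\int[lebesgue_Rn R d]_x (kappa * gker mu 1 x)%:E = 1)%E.

(* Normalisation of the sampling law makes the mass of [gker 0 1] finite without
   evaluating any Gaussian integral. *)
Lemma gker_mass : exists2 C : R, 0 < C & forall m s, 0 < s ->
  (\int[lebesgue_Rn R d]_x (gker m s x)%:E = (Num.sqrt s ^+ d * C)%:E)%E.
Proof.
have [C C0 CE] : exists2 C : R, 0 < C &
    (\int[lebesgue_Rn R d]_x (gker 0 1 x)%:E = C%:E)%E.
  pose I := (\int[lebesgue_Rn R d]_x (gker 0 1 x)%:E)%E.
  have I0 : (0 <= I)%E by apply: integral_ge0 => x _; rewrite lee_fin gker_ge0.
  have kI : (kappa%:E * I = 1)%E.
    have := integral_gker mu (@ltr01 R); rewrite sqrtr1 expr1n mul1e => IE.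
    by rewrite /I -IE -(integral_EFinZl _ (measurable_gker mu 1) (gker_ge0 mu 1)).
  rewrite -/I; case: I I0 kI => [r r0 /eqP|_|//].
    rewrite -EFinM eqe => /eqP kr; exists r => //.
    rewrite lt_neqAle -lee_fin r0 andbT eq_sym; apply/eqP => r00.
    by move: kr; rewrite r00 mulr0 => /esym/eqP; rewrite oner_eq0.
  (* Infinite mass is excluded: its product with [kappa] would be 0 or infinite, not 1. *)
  move: kappa0; rewrite le_eqVlt => /predU1P[<-|k0].
    by rewrite mul0e => -[] /esym/eqP; rewrite oner_eq0.
  by rewrite gt0_muley.
by exists C => // m s s0; rewrite integral_gker// CE -EFinM.
Qed.

(** * One update: from the law of a state to the law of the next *)

Variables (gamma nu : probability (d.-tuple R) R) (c e : R).
Hypothesis e0 : 0 < e.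
Hypothesis gammaE :
  has_density (lebesgue_Rn R d) gamma (fun x => kappa * gker mu 1 x).

Local Notation step := (sgd_step c e).

Lemma measurable_sgd_step : measurable_fun setT step.
Proof.
apply/measurable_fun_tnthP => i.
rewrite (_ : _ \o _ = (fun z : d.-tuple R * d.-tuple R =>
    e * tnth z.2 i + c * tnth z.1 i)); last first.
  by apply/funext => z /=; rewrite tnth_mktuple tnth_mktuple !mxE.
apply: measurable_funD; apply: measurable_funM => //.
  exact: (measurableT_comp (@measurable_tnth _ _ d i) measurable_snd).
exact: (measurableT_comp (@measurable_tnth _ _ d i) measurable_fst).
Qed.

(** Transition density: the density in [y] of [c z + e x] for [x] of law [gamma], with Jacobian
    [e ^- d]. *)
Let M z y := kappa * e ^- d * gker (c *: vec_of z + e *: mu) (e ^+ 2) y.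

Let M0 z y : 0 <= M z y.
Proof. by rewrite mulr_ge0 ?gker_ge0// mulr_ge0// invr_ge0 exprn_ge0// ltW. Qed.

Let mM : measurable_fun setT (fun z : d.-tuple R * d.-tuple R => M z.1 z.2).
Proof. by apply: measurable_funM => //; exact: measurable_gker2. Qed.

Let mMz z : measurable_fun setT (M z).
Proof. by apply: measurable_funM => //; exact: measurable_gker. Qed.

Let gamma_step z A : measurable A ->
  gamma [set x | A (step (z, x))] = (\int[lebesgue_Rn R d]_y (\1_A y * M z y)%:E)%E.
Proof.
move=> mA; rewrite gammaE; last first.
  rewrite -[X in measurable X]setTI.
  exact: (@measurable_affine_tuple R d e (tuple_of_cV (c *: vec_of z))).
pose f y := \1_A y * (kappa * gker (c *: vec_of z + e *: mu) (e ^+ 2) y).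
have mf : measurable_fun setT f.
  by apply: measurable_funM => //; apply: measurable_funM => //; exact: measurable_gker.
have f0 y : 0 <= f y by rewrite mulr_ge0// mulr_ge0// gker_ge0.
transitivity (\int[lebesgue_Rn R d]_x
    (f (affine_tuple e (tuple_of_cV (c *: vec_of z)) x))%:E)%E.
  apply: eq_integral => x _; rewrite /f; congr (_ * (_ * _))%:E.
  have E := @gker_affine e 1 mu (tuple_of_cV (c *: vec_of z)) x e0.
  by rewrite mulr1 tuple_of_cVK addrC in E; exact: esym E.
rewrite (lebesgue_Rn_affine _ e0 mf f0) -(integral_EFinZl _ mf f0); last first.
  by rewrite invr_ge0 exprn_ge0// ltW.
apply: eq_integral => y _; rewrite /f /M; congr EFin.
by move: (e ^- d) => ed; ring.
Qed.

(** The product measure is by definition the [nu]-integral of the [gamma]-measure of sections, and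
    [gamma_step] evaluates each section. *)
Let law_step A : measurable A -> (nu \x gamma)%E (step @^-1` A) =
  (\int[nu]_z \int[lebesgue_Rn R d]_y (\1_A y * M z y)%:E)%E.
Proof.
move=> mA; apply: eq_integral => z _ /=; rewrite -gamma_step//.
by congr (gamma _); apply/seteqP; split => x; rewrite /xsection/= inE.
Qed.

Let mAM A : measurable A -> measurable_fun setT
  (fun z : d.-tuple R * d.-tuple R => (\1_A z.2 * M z.1 z.2)%:E).
Proof.
move=> mA; apply/measurable_EFinP; apply: measurable_funM => //.
by apply: measurableT_comp => //; exact: measurable_indic.
Qed.

(** The first update starts at a deterministic point, with covariance factor 0; the new law is given
    by the transition density at [t]. *)
Lemma law_step_dirac t : (forall A, measurable A -> nu A = \d_t A) ->
  exists2 K : R, 0 <= K & has_density (lebesgue_Rn R d)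
    (fun A => (nu \x gamma)%E (step @^-1` A))
    (fun y => K * gker (c *: vec_of t + e *: mu) (e ^+ 2) y).
Proof.
move=> nuE; exists (kappa * e ^- d).
  by rewrite mulr_ge0// invr_ge0 exprn_ge0// ltW.
move=> A mA; rewrite law_step//.
rewrite (eq_measure_integral (\d_t)); last by move=> B mB _; exact: nuE.
rewrite integral_dirac//; last first.
  apply: (measurable_fun_fubini_tonelli_F (m2 := lebesgue_Rn R d)
    (fun z : d.-tuple R * d.-tuple R => (\1_A z.2 * M z.1 z.2)%:E)).
    exact: mAM.
  by move=> z; rewrite lee_fin mulr_ge0.
by rewrite diracT mul1e.
Qed.

(** Gaussian convolution: after Tonelli, completing the square for fixed [y] splits off a kernel in
    [z] whose mass does not depend on [y]. *)
Lemma law_step_gauss K m s : 0 <= K -> 0 < s ->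
  has_density (lebesgue_Rn R d) nu (fun x => K * gker m s x) ->
  exists2 K' : R, 0 <= K' & has_density (lebesgue_Rn R d)
    (fun A => (nu \x gamma)%E (step @^-1` A))
    (fun y => K' * gker (c *: m + e *: mu) (e ^+ 2 + c ^+ 2 * s) y).
Proof.
move=> K0 s0 nuE; have [C C0 CE] := gker_mass.
have e20 : 0 < e ^+ 2 by rewrite exprn_gt0.
pose D := e ^+ 2 + c ^+ 2 * s.
have D0 : 0 < D by rewrite (lt_le_trans e20)// lerDl mulr_ge0 ?sqr_ge0// ltW.
(* Factor of the conditional covariance of the old state given the new value [y]; the conditional
   mean is [mm] below. *)
pose r := s * e ^+ 2 / D.
have r0 : 0 < r by rewrite divr_gt0// mulr_gt0.
have ked0 : 0 <= kappa * e ^- d.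
  by rewrite mulr_ge0// invr_ge0 exprn_ge0// ltW.
(* The last factor is the mass of the kernel in [z], the same for every centre. *)
exists (kappa * e ^- d * K * (Num.sqrt r ^+ d * C)).
  by rewrite mulr_ge0//; [exact: mulr_ge0|rewrite mulr_ge0 ?exprn_ge0 ?sqrtr_ge0// ltW].
move=> A mA; rewrite law_step//.
pose F (z : d.-tuple R * d.-tuple R) : \bar R :=
  ((\1_A z.2 * M z.1 z.2) * (K * gker m s z.1))%:E.
have mF : measurable_fun setT F.
  apply/measurable_EFinP; apply: measurable_funM.
    by apply/measurable_EFinP; exact: mAM.
  apply: measurable_funM => //.
  exact: (measurableT_comp (measurable_gker m s) measurable_fst).
have F0 z : (0 <= F z)%E.
  by rewrite lee_fin; apply: mulr_ge0; rewrite mulr_ge0// gker_ge0.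
have mKg : measurable_fun setT (fun x => K * gker m s x).
  by apply: measurable_funM => //; exact: measurable_gker.
rewrite (integral_has_density mKg _ nuE); last 3 first.
- by move=> x; rewrite mulr_ge0// gker_ge0.
- apply: (measurable_fun_fubini_tonelli_F (m2 := lebesgue_Rn R d)
    (fun z : d.-tuple R * d.-tuple R => (\1_A z.2 * M z.1 z.2)%:E)).
    exact: mAM.
  by move=> z; rewrite lee_fin mulr_ge0.
- by move=> z; apply: integral_ge0 => y _; rewrite lee_fin mulr_ge0.
transitivity (\int[lebesgue_Rn R d]_z \int[lebesgue_Rn R d]_y F (z, y))%E.
  apply: eq_integral => z _; rewrite -ge0_integralZr//.
  - apply/measurable_EFinP; apply: measurable_funM; last exact: mMz.
    exact: measurable_indic.
  - by move=> y _; rewrite lee_fin mulr_ge0.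
  - by rewrite lee_fin mulr_ge0// gker_ge0.
rewrite (fubini_tonelli F mF F0).
apply: eq_integral => y _; rewrite /F/=.
pose zz : 'cV[R]_d := vec_of y - (c *: m + e *: mu).
pose mm := m + (c * s / D) *: zz.
transitivity (\int[lebesgue_Rn R d]_z
  ((\1_A y * (kappa * e ^- d * K * gker (c *: m + e *: mu) D y)) *
   gker mm r z)%:E)%E.
  apply: eq_integral => z _; congr EFin.
  rewrite /M; suff E : gker (c *: vec_of z + e *: mu) (e ^+ 2) y * gker m s z =
      gker (c *: m + e *: mu) D y * gker mm r z.
    transitivity (\1_A y * (kappa * e ^- d * K) *
      (gker (c *: vec_of z + e *: mu) (e ^+ 2) y * gker m s z)).
      by move: (e ^- d) (gker _ _ _) (gker _ _ _) => ed g1 g2; ring.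
    by rewrite E; move: (e ^- d) (gker _ _ _) (gker _ _ _) => ed g1 g2; ring.
  rewrite /gker -!expRD -!opprD; congr (expR (- _)).
  pose w : 'cV[R]_d := vec_of z - m.
  have -> : vec_of y - (c *: vec_of z + e *: mu) = zz - c *: w.
    by rewrite /zz /w scalerBr; apply/matrixP => i j; rewrite !mxE; ring.
  have -> : vec_of z - mm = w - (c * s / D) *: zz.
    by rewrite /mm /w opprD addrA.
  have H := mahal_conv Spd c w zz s0 e20; rewrite -/D -/r in H.
  have Ei (q t : R) : (2 * t)^-1 * q = 2^-1 * (t^-1 * q) by rewrite invfM mulrA.
  by rewrite !Ei -!mulrDr addrC H addrC.
rewrite (integral_EFinZl _ (measurable_gker mm r) (gker_ge0 mm r)); last first.
  by rewrite mulr_ge0// mulr_ge0 ?gker_ge0// mulr_ge0.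
rewrite CE// -EFinM; congr EFin; rewrite -/D.
by move: (e ^- d) (Num.sqrt r ^+ d) (gker _ _ _) => ed q g; ring.
Qed.

End normalized.
End gaussian_kernel.

(** * Laws of recursions driven by independent inputs *)

Definition law_of dO (Omega : measurableType dO) (R : realType)
    (P : probability Omega R) dT (T : measurableType dT) (f : Omega -> T)
    (mf : measurable_fun setT f) : probability T R :=
  distribution P (mfun_Sub (mem_set mf)).

Lemma law_ofE dO (Omega : measurableType dO) (R : realType)
    (P : probability Omega R) dT (T : measurableType dT) (f : Omega -> T)
    (mf : measurable_fun setT f) A : law_of P mf A = P (f @^-1` A).
Proof. by []. Qed.

Section recursion_independence.
Context dO (Omega : measurableType dO) (R : realType) (P : probability Omega R).
Context dT (T : measurableType dT) dU (U : measurableType dU).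
Variables (k : nat) (theta : nat -> Omega -> T) (Y : nat -> Omega -> U).
Variables (upd : T * U -> T) (t0 : T).
Hypothesis mY : forall i, (i < k)%N -> measurable_fun setT (Y i).
Hypothesis mupd : measurable_fun setT upd.
Hypothesis theta0 : forall w, theta 0 w = t0.
Hypothesis thetaS : forall i w, theta i.+1 w = upd (theta i w, Y i w).
Hypothesis indep : forall A : 'I_k -> set U, (forall j, measurable (A j)) ->
  P (\bigcap_(j in [set: 'I_k]) (Y j @^-1` A j)) =
  (\prod_(j : 'I_k) P (Y j @^-1` A j))%E.

Lemma measurable_recursion i : (i <= k)%N -> measurable_fun setT (theta i).
Proof.
elim: i => [_|i IH ik].
  by rewrite (_ : theta 0 = cst t0)//; apply/funext => w; rewrite theta0.
rewrite (_ : theta i.+1 = upd \o (fun w => (theta i w, Y i w))); last first.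
  by apply/funext => w; rewrite thetaS.
apply: (measurableT_comp mupd); apply/measurable_fun_pairP.
by split; [exact: IH (ltnW ik)|exact: mY].
Qed.

(** Event that the inputs not yet consumed at time [i] fall in prescribed sets. The induction
    invariant is that [theta i] is independent of all such events. *)
Let future i (A : nat -> set U) : set Omega :=
  \bigcap_(j in [set j : 'I_k | (i <= j)%N]) (Y j @^-1` A j).

Let measurable_preY i B : (i < k)%N -> measurable B -> measurable (Y i @^-1` B).
Proof. by move=> ik mB; rewrite -[X in measurable X]setTI; exact: mY. Qed.

Let measurable_future i A : (forall j, measurable (A j)) -> measurable (future i A).
Proof.
move=> mA; rewrite /future; apply: fin_bigcap_measurable; first exact: finite_finset.
by move=> j _; exact: measurable_preY.
Qed.

(** Allowing the whole space before time [i] turns the event into a full product event. *)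
Let future_prod i A : (forall j, measurable (A j)) ->
  P (future i A) = (\prod_(j < k | (i <= j)%N) P (Y j @^-1` A j))%E.
Proof.
move=> mA; pose A' (j : 'I_k) := if (i <= j)%N then A j else setT.
have -> : future i A = \bigcap_(j in [set: 'I_k]) (Y j @^-1` A' j).
  apply/seteqP; split => w H j.
    by move=> _; rewrite /A' /=; case: ifPn => // ij; exact: H.
  by move=> /= ij; have := H j I; rewrite /A' /= ij.
rewrite indep; last by move=> j; rewrite /A'; case: ifP.
rewrite [RHS]big_mkcond; apply: eq_bigr => j _; rewrite /A'.
by case: ifP => // _; rewrite preimage_setT probability_setT.
Qed.

(** A condition on [Y i] is independent of the later inputs, and joined to a later event it is again
    an event of the form [future i]; this is how the induction hypothesis gets applied. *)
Let future_cons i A B : (i < k)%N -> (forall j, measurable (A j)) -> measurable B ->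
  P (Y i @^-1` B `&` future i.+1 A) = (P (Y i @^-1` B) * P (future i.+1 A))%E /\
  exists2 A', (forall j, measurable (A' j)) &
    Y i @^-1` B `&` future i.+1 A = future i A'.
Proof.
move=> ik mA mB; pose A' j := if j == i then B else A j.
have mA' j : measurable (A' j) by rewrite /A'; case: ifP.
have E : Y i @^-1` B `&` future i.+1 A = future i A'.
  apply/seteqP; split => w.
    move=> [Bw Aw] j /= ij; rewrite /A'; case: eqP => [->//|/eqP ji].
    by apply: Aw => /=; rewrite ltn_neqAle eq_sym ji.
  move=> Aw; split; first by have := Aw (Ordinal ik) (leqnn i); rewrite /A' /= eqxx.
  move=> j /= ij; have := Aw j (ltnW ij).
  by rewrite /A' /= gtn_eqF.
split; last by exists A'.
rewrite E !future_prod// (bigD1 (Ordinal ik))//=; congr (_ * _)%E.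
  by rewrite /A' eqxx.
apply: eq_big => j; first by rewrite ltn_neqAle andbC eq_sym.
by rewrite -val_eqE /= /A' => /andP[_ /negbTE ->].
Qed.

Let future_T i : future i (fun=> setT) = setT.
Proof. by apply/seteqP; split. Qed.

Let pair i w := (theta i w, Y i w).

Let measurable_pair i : (i < k)%N -> measurable_fun setT (pair i).
Proof.
move=> ik; apply/measurable_fun_pairP.
by split; [exact: measurable_recursion (ltnW ik)|exact: mY].
Qed.

(** Restricted to a later event, the state and its input have the product law scaled by the
    probability of that event: the two measures agree on rectangles, which determines them. *)
Let pair_future i (ik : (i < k)%N) :
  (forall A B, (forall j, measurable (A j)) -> measurable B ->
    P (theta i @^-1` B `&` future i A) = (P (theta i @^-1` B) * P (future i A))%E) ->
  forall A C, (forall j, measurable (A j)) -> measurable C ->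
  P (pair i @^-1` C `&` future i.+1 A) =
  (P (future i.+1 A) *
   (law_of P (measurable_recursion (ltnW ik)) \x law_of P (mY ik)) C)%E.
Proof.
move=> IH A C mA mC.
have mE := measurable_future i.+1 mA.
set nu := law_of _ _; set gam := law_of _ _.
have PE : P (future i.+1 A) = (fine (P (future i.+1 A)))%:E.
  by rewrite fineK// fin_num_measure.
(* The scaling goes into the first factor, so that the candidate is still a product measure and
   uniqueness on rectangles applies. *)
pose pE : {nonneg R} := NngNum (fine_ge0 (measure_ge0 P (future i.+1 A))).
pose M := image_measure (mrestr P mE) (measurable_pair ik).
pose m1 : {finite_measure set T -> \bar R} := mscale pE nu.
have -> : P (pair i @^-1` C `&` future i.+1 A) = M C by [].
rewrite -(@product_measure_unique _ _ _ _ _ m1 gam M)//; last first.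
  move=> B D mB mD.
  have [H [A' mA' E]] := future_cons ik mA mD.
  have -> : M (B `*` D) = P (theta i @^-1` B `&` future i A').
    by rewrite -E setIA; congr (P (_ `&` _)).
  rewrite IH// -E H.
  transitivity (P (future i.+1 A) * P (theta i @^-1` B) * P (Y i @^-1` D))%E.
    by rewrite muleA -[RHS]muleA [RHS]muleC.
  by rewrite {1}PE.
rewrite [LHS]/product_measure1 ge0_integral_mscale//=; last exact: measurable_fun_xsection.
by rewrite -PE.
Qed.

Let theta_future i : (i <= k)%N -> forall A B, (forall j, measurable (A j)) ->
  measurable B ->
  P (theta i @^-1` B `&` future i A) = (P (theta i @^-1` B) * P (future i A))%E.
Proof.
elim: i => [_|i IH ik] A B mA mB.
  have -> : theta 0 = cst t0 by apply/funext => w; rewrite theta0.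
  rewrite preimage_cst; case: ifPn => _; first by rewrite setTI probability_setT mul1e.
  by rewrite set0I measure0 mul0e.
have mC : measurable (upd @^-1` B) by rewrite -[X in measurable X]setTI; exact: mupd.
have E A' (mA' : forall j, measurable (A' j)) :
    P (theta i.+1 @^-1` B `&` future i.+1 A') = (P (future i.+1 A') *
   (law_of P (measurable_recursion (ltnW ik)) \x law_of P (mY ik)) (upd @^-1` B))%E.
  rewrite -(@pair_future i ik (IH (ltnW ik)) A' _ mA' mC); congr (P (_ `&` _)).
  by apply/seteqP; split => w; rewrite /= thetaS.
(* With the trivial later event, [E] identifies its product-law factor with the probability that
   [theta i.+1] lies in [B]. *)
rewrite E//; have := E (fun=> setT) (fun=> measurableT).
by rewrite future_T setIT probability_setT mul1e => ->; rewrite muleC.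
Qed.

(** The case of the trivial later event: a state is independent of its fresh input, so the next law
    is the image of their product law. *)
Lemma law_recursionS i (ik : (i < k)%N) B : measurable B ->
  P (theta i.+1 @^-1` B) =
  (law_of P (measurable_recursion (ltnW ik)) \x law_of P (mY ik))%E (upd @^-1` B).
Proof.
move=> mB.
have mC : measurable (upd @^-1` B) by rewrite -[X in measurable X]setTI; exact: mupd.
have := @pair_future i ik (theta_future (ltnW ik)) _ _ (fun=> measurableT) mC.
rewrite future_T setIT probability_setT mul1e => <-; congr (P _).
by apply/seteqP; split => w; rewrite /= thetaS.
Qed.

End recursion_independence.

(** * Renyi divergence of the iterates *)

Lemma intRn_has_density (R : realType) (d : nat) (law : set (d.-tuple R) -> \bar R)
    (f : d.-tuple R -> R) : (forall x, 0 <= f x) -> measurable_fun setT f ->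
  (forall A, measurable A -> law A = intRn (fun x => (\1_A x * f x)%:E)) ->
  has_density (lebesgue_Rn R d) law f.
Proof.
move=> f0 mf lE A mA; rewrite lE// intRnE//.
  by apply/measurable_EFinP; apply: measurable_funM.
by move=> x; rewrite lee_fin mulr_ge0.
Qed.

Section renyi_gauss.
Context (R : realType) (d : nat) (S : 'M[R]_d).
Hypothesis Spd : sym_posdef S.

(** By [mahal_renyi]; the new centre is [a m + (1 - a) n], and the exponential factor does not
    depend on [x]. *)
Lemma gker_powR (a : R) (m n : 'cV[R]_d) (s : R) x :
  gker S m s x `^ a * gker S n s x `^ (1 - a) =
  expR ((2 * s)^-1 * (a * (a - 1)) * mahal S (m - n)) *
  gker S (m - (1 - a) *: (m - n)) s x.
Proof.
rewrite /gker -!expRM -!expRD; congr expR.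
have := mahal_renyi Spd a (vec_of x - m) (m - n).
have -> : vec_of x - m + (m - n) = vec_of x - n by rewrite addrA subrK.
have -> : vec_of x - m + (1 - a) *: (m - n) = vec_of x - (m - (1 - a) *: (m - n)).
  by rewrite opprB addrA addrAC.
move: (mahal _ _) (mahal _ _) (mahal _ _) (mahal _ _) => q1 q2 q3 q4 E.
have -> : q2 = a * q4 + (1 - a) * q3 - a * (1 - a) * q1 by rewrite E; ring.
by move: ((2 * s)^-1) => i; ring.
Qed.

Variables (mu : 'cV[R]_d) (kappa : R).
Hypothesis kappa0 : 0 <= kappa.
Hypothesis kappa1 : (\int[lebesgue_Rn R d]_x (kappa * gker S mu 1 x)%:E = 1)%E.

(** The densities are replaced almost everywhere by kernels with a common constant; the integral is
    then the factor from [gker_powR] times the mass of a normalised kernel, and the logarithm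
    returns the exponent. *)
Lemma renyi_div_gauss (lawp lawq : set (d.-tuple R) -> \bar R) (p q : d.-tuple R -> R)
    (m n : 'cV[R]_d) (s a K1 K2 : R) :
  0 < s -> 1 < a -> 0 <= K1 -> 0 <= K2 ->
  lawp setT = 1%E -> lawq setT = 1%E ->
  is_density lawp p -> is_density lawq q ->
  has_density (lebesgue_Rn R d) lawp (fun x => K1 * gker S m s x) ->
  has_density (lebesgue_Rn R d) lawq (fun x => K2 * gker S n s x) ->
  renyi_div a p q = (a / (2 * s) * mahal S (m - n))%:E.
Proof.
move=> s0 a1 K10 K20 p1 q1 [p0 mp pE] [q0 mq qE] Hp Hq.
have [C C0 CE] := gker_mass kappa0 kappa1.
have mK K m' : measurable_fun setT (fun x => K * gker S m' s x).
  by apply: measurable_funM => //; exact: measurable_gker.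
(* Total mass 1 determines the constant from [s] alone, which forces [K1] and [K2] to be equal. *)
have mass K (law : set (d.-tuple R) -> \bar R) m' : 0 <= K -> law setT = 1%E ->
    has_density (lebesgue_Rn R d) law (fun x => K * gker S m' s x) ->
    K * (Num.sqrt s ^+ d * C) = 1.
  move=> K'0 l1 lE; apply: EFin_inj; rewrite -l1 lE// EFinM -(CE m')//.
  rewrite -(integral_EFinZl _ (measurable_gker S m' s) (gker_ge0 S m' s))//.
  by apply: eq_integral => x _; rewrite indicT mul1r.
have m1 := mass _ _ _ K10 p1 Hp.
have m2 := mass _ _ _ K20 q1 Hq.
have Z0 : Num.sqrt s ^+ d * C != 0.
  by apply/eqP => Z; move: m1; rewrite Z mulr0 => /esym/eqP; rewrite oner_eq0.
have K12 : K2 = K1 by apply: (mulIf Z0); rewrite m1 m2.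
have K1gt : 0 < K1.
  rewrite lt_neqAle K10 andbT; apply/eqP => K1e.
  by move: m1; rewrite -K1e mul0r => /esym/eqP; rewrite oner_eq0.
rewrite K12 in Hq.
have aep : ae_eq (lebesgue_Rn R d) setT (EFin \o p)
    (EFin \o (fun x => K1 * gker S m s x)).
  have fin : (lawp setT < +oo)%E by rewrite p1 ltry.
  exact: (has_density_ae_eq mp (mK K1 m) p0 fin (intRn_has_density p0 mp pE) Hp).
have aeq : ae_eq (lebesgue_Rn R d) setT (EFin \o q)
    (EFin \o (fun x => K1 * gker S n s x)).
  have fin : (lawq setT < +oo)%E by rewrite q1 ltry.
  exact: (has_density_ae_eq mq (mK K1 n) q0 fin (intRn_has_density q0 mq qE) Hq).
pose F (f g : d.-tuple R -> R) x : \bar R := (f x `^ a * g x `^ (1 - a))%:E.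
have mF (f g : d.-tuple R -> R) : measurable_fun setT f -> measurable_fun setT g ->
    measurable_fun setT (F f g).
  move=> mf mg; apply/measurable_EFinP; apply: measurable_funM.
    exact: (measurableT_comp (measurable_powR a) mf).
  exact: (measurableT_comp (measurable_powR (1 - a)) mg).
have F0 f g x : (0 <= F f g x)%E by rewrite lee_fin mulr_ge0// powR_ge0.
pose E := expR ((2 * s)^-1 * (a * (a - 1)) * mahal S (m - n)).
have IE : intRn (F p q) = E%:E.
  rewrite (intRnE (mF _ _ mp mq) (F0 p q)).
  transitivity (\int[lebesgue_Rn R d]_x
      F (fun x => K1 * gker S m s x)%R (fun x => K1 * gker S n s x)%R x)%E.
    apply: ge0_ae_eq_integral;
      [exact: measurableT|exact: mF|exact: mF|by move=> x _|by move=> x _|].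
    apply: filterS2 aep aeq => x /= /(_ I) [px] /(_ I) [qx] _.
    by rewrite /F px qx.
  transitivity (\int[lebesgue_Rn R d]_x
      ((K1 * E) * gker S (m - (1 - a) *: (m - n)) s x)%:E)%E.
    apply: eq_integral => x _; congr EFin.
    (* The constants combine to [K1], since the exponents [a] and [1 - a] add up to 1. *)
    rewrite !powRM ?gker_ge0// mulrACA gker_powR mulrA; congr (_ * _ * _).
    rewrite -powRD; last by apply/implyP => _; rewrite gt_eqF.
    by rewrite (_ : a + (1 - a) = 1) ?powRr1//; ring.
  rewrite integral_EFinZl; last 3 first.
  - exact: measurable_gker.
  - exact: gker_ge0.
  - by rewrite mulr_ge0// expR_ge0.
  by rewrite CE// -EFinM mulrAC m1 mul1r.
rewrite /renyi_div -/(F p q) IE /E expRK; congr EFin.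
have a10 : a - 1 != 0 by rewrite subr_eq0 gt_eqF.
by field; rewrite a10 gt_eqF.
Qed.

End renyi_gauss.

(** * Means, covariance factors and laws of the iterates *)

Section sgd_law.
Context (R : realType) (d : nat) (S : 'M[R]_d).
Hypothesis Spd : sym_posdef S.
Variables (mu : 'cV[R]_d) (kappa c e : R).
Hypothesis kappa0 : 0 <= kappa.
Hypothesis kappa1 : (\int[lebesgue_Rn R d]_x (kappa * gker S mu 1 x)%:E = 1)%E.
Hypothesis e0 : 0 < e.

Definition sgd_mean (m0 : 'cV[R]_d) (i : nat) : 'cV[R]_d :=
  iter i (fun m => c *: m + e *: mu) m0.

(** Factor of [S] in the covariance of an iterate; it starts at 0 because the initial state is
    deterministic. *)
Definition sgd_scale (i : nat) : R := iter i (fun s => e ^+ 2 + c ^+ 2 * s) 0.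

(** The common drift [e *: mu] cancels in the difference, which each step multiplies by [c]. *)
Lemma sgd_meanB m n i : sgd_mean m i - sgd_mean n i = c ^+ i *: (m - n).
Proof.
elim: i => [|i IH]; first by rewrite expr0 scale1r.
by rewrite /= opprD addrACA subrr addr0 -scalerBr IH scalerA exprS.
Qed.

Lemma sgd_scale_ge0 i : 0 <= sgd_scale i.
Proof. by elim: i => //= i IH; rewrite addr_ge0 ?sqr_ge0// mulr_ge0 ?sqr_ge0. Qed.

Lemma sgd_scaleS_gt0 i : 0 < sgd_scale i.+1.
Proof.
by rewrite /= ltr_pwDl ?exprn_gt0// mulr_ge0 ?sqr_ge0// sgd_scale_ge0.
Qed.

(** The scale is [e ^+ 2] times the sum of [c ^+ (2 * j)] over [j < i], and each of these powers is
    at least [c ^+ (2 * i)]. *)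
Lemma sgd_scale_lb i : 0 <= c <= 1 -> i%:R * e ^+ 2 * c ^+ (2 * i) <= sgd_scale i.
Proof.
move=> /andP[c0 c1]; elim: i => [|i IH]; first by rewrite !mul0r.
rewrite [sgd_scale _]/= -/(sgd_scale i) -natr1 !mulrDl mul1r addrC lerD//.
  by rewrite ler_piMr ?sqr_ge0// exprn_ile1.
rewrite mulnS exprD mulrCA ler_wpM2l// ?sqr_ge0//.
Qed.

Context dO (Omega : measurableType dO) (P : probability Omega R).
Variables (k : nat) (theta Y : nat -> Omega -> d.-tuple R) (t0 : d.-tuple R).
Hypothesis mY : forall i, (i < k)%N -> measurable_fun setT (Y i).
Hypothesis YE : forall i, (i < k)%N -> has_density (lebesgue_Rn R d)
  (fun A => P (Y i @^-1` A)) (fun x => kappa * gker S mu 1 x).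
Hypothesis thetaO : forall w, theta 0 w = t0.
Hypothesis thetaS : forall i w, theta i.+1 w = sgd_step c e (theta i w, Y i w).
Hypothesis indep : forall A : 'I_k -> set (d.-tuple R), (forall j, measurable (A j)) ->
  P (\bigcap_(j in [set: 'I_k]) (Y j @^-1` A j)) =
  (\prod_(j : 'I_k) P (Y j @^-1` A j))%E.

(** The first update leaves a point mass and uses [law_step_dirac]; from then on the scale is
    positive and [law_step_gauss] applies. Hence the index [i.+1]. *)
Lemma sgd_density i : (i < k)%N -> exists2 K : R, 0 <= K &
  has_density (lebesgue_Rn R d) (fun A => P (theta i.+1 @^-1` A))
    (fun x => K * gker S (sgd_mean (vec_of t0) i.+1) (sgd_scale i.+1) x).
Proof.
have mst := @measurable_sgd_step R d c e.
elim: i => [|i IH] ik.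
  have nuE A : measurable A ->
      law_of P (measurable_recursion mY mst thetaO thetaS (ltnW ik)) A = \d_t0 A.
    move=> mA; rewrite law_ofE.
    rewrite (_ : theta 0 = cst t0); last by apply/funext => w; rewrite thetaO.
    rewrite preimage_cst diracE.
    by case: ifPn => _; rewrite ?probability_setT ?measure0.
  have [K K0 KE] := law_step_dirac kappa0 c e0 (gamma := law_of P (mY ik)) (YE ik) nuE.
  exists K; [exact: K0|move=> A mA].
  have -> : sgd_scale 1 = e ^+ 2 by rewrite /sgd_scale/= mulr0 addr0.
  exact: (etrans (law_recursionS mY mst thetaO thetaS indep ik mA) (KE A mA)).
have [K K0 KE] := IH (ltnW ik).
have [K' K'0 K'E] := law_step_gauss Spd kappa0 kappa1 c e0 (gamma := law_of P (mY ik))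
  (nu := law_of P (measurable_recursion mY mst thetaO thetaS (ltnW ik)))
  (YE ik) K0 (sgd_scaleS_gt0 i) KE.
exists K'; [exact: K'0|move=> A mA].
exact: (etrans (law_recursionS mY mst thetaO thetaS indep ik mA) (K'E A mA)).
Qed.

End sgd_law.

(** * Specialisation to the two SGD runs *)

Lemma gauss_pdfE (R : realType) (d : nat) (mu : 'cV[R]_d) (S : 'M[R]_d) x :
  gauss_pdf mu S x = (Num.sqrt ((2 * pi) ^+ d * \det S))^-1 * gker S mu 1 x.
Proof.
rewrite /gauss_pdf /gker mulrC; congr (_ * expR _).
by rewrite mulr1 div1r mulNr.
Qed.

(** Joint independence over both runs restricts to one by taking the whole space for the other,
    whose factors are then 1. *)
Lemma independent_slice dO (Omega : measurableType dO) (R : realType)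
    (P : probability Omega R) dT (T : measurableType dT) (k : nat)
    (X : bool -> nat -> Omega -> T) :
  (forall A : bool * 'I_k -> set T, (forall j, measurable (A j)) ->
      P (\bigcap_(j in [set: bool * 'I_k]) (X j.1 j.2 @^-1` A j)) =
      (\prod_(j : bool * 'I_k) P (X j.1 j.2 @^-1` A j))%E) ->
  forall b (A : 'I_k -> set T), (forall j, measurable (A j)) ->
  P (\bigcap_(j in [set: 'I_k]) (X b j @^-1` A j)) =
  (\prod_(j : 'I_k) P (X b j @^-1` A j))%E.
Proof.
move=> indep b A mA.
pose A' (j : bool * 'I_k) := if j.1 == b then A j.2 else setT.
have -> : \bigcap_(j in [set: 'I_k]) (X b j @^-1` A j) =
    \bigcap_(j in [set: bool * 'I_k]) (X j.1 j.2 @^-1` A' j).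
  apply/seteqP; split => w H.
    by move=> [b' j] _; rewrite /A' /=; case: eqP => //= ->; exact: H.
  by move=> j _; have := H (b, j) I; rewrite /A' /= eqxx.
rewrite indep; last by move=> j; rewrite /A'; case: ifP.
rewrite -(pair_bigA _ (fun b' (j : 'I_k) => P (X b' j @^-1` A' (b', j))))/=.
rewrite (bigD1 b)//= [X in (_ * X)%E]big1 ?mule1; last first.
  move=> b' /negbTE b'b; rewrite big1// => j _.
  by rewrite /A' /= b'b preimage_setT probability_setT.
by apply: eq_bigr => j _; rewrite /A' /= eqxx.
Qed.

Theorem theorem1 (R : realType) (d : nat) (mu : 'cV[R]_d) (Sigma : 'M[R]_d)
    (theta0 v : 'cV[R]_d) (eta : R) (k : nat)
    (dO : measure_display) (Omega : measurableType dO) (P : probability Omega R)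
    (X : bool -> nat -> Omega -> d.-tuple R) :
  (0 < d)%N -> sym_posdef Sigma ->
  0 < eta -> eta < 1/2 -> (0 < k)%N ->
  (forall b i, (i < k)%N -> measurable_fun setT (X b i)) ->
  (forall b i, (i < k)%N -> forall A, measurable A ->
      P (X b i @^-1` A) = intRn (fun x => (\1_A x * gauss_pdf mu Sigma x)%:E)) ->
  (forall A : bool * 'I_k -> set (d.-tuple R), (forall j, measurable (A j)) ->
      P (\bigcap_(j in [set: bool * 'I_k]) (X j.1 j.2 @^-1` A j)) =
      (\prod_(j : bool * 'I_k) P (X j.1 j.2 @^-1` A j))%E) ->
  forall alpha : R, 1 < alpha ->
  forall p q : d.-tuple R -> R,
    is_density (fun A : set (d.-tuple R) =>
        P ((fun w => tuple_of_cV (sgd_theta eta theta0 v X true k w)) @^-1` A)) p ->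
    is_density (fun A : set (d.-tuple R) =>
        P ((fun w => tuple_of_cV (sgd_theta eta theta0 v X false k w)) @^-1` A)) q ->
    (renyi_div alpha p q <=
       ((2 * alpha / k%:R) * (v^T *m invmx Sigma *m v) ord0 ord0)%:E)%E.
Proof.
move=> _ Spd eta0 eta1 k0 mX XE indep alpha alpha1 p q pE qE.
pose e := 2 * eta; pose c := 1 - 2 * eta.
have e0 : 0 < e by rewrite mulr_gt0.
have c0 : 0 < c by rewrite /c; lra.
have c1 : 0 <= c <= 1 by rewrite /c; apply/andP; split; lra.
pose kappa := (Num.sqrt ((2 * pi) ^+ d * \det Sigma))^-1.
have kappa0 : 0 <= kappa by rewrite invr_ge0 sqrtr_ge0.
have XD b i : (i < k)%N -> has_density (lebesgue_Rn R d)
    (fun A => P (X b i @^-1` A)) (fun x => kappa * gker Sigma mu 1 x).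
  move=> ik; apply: intRn_has_density.
  - by move=> x; rewrite mulr_ge0// gker_ge0.
  - by apply: measurable_funM => //; exact: measurable_gker.
  - move=> A mA; rewrite XE//; congr intRn; apply/funext => x.
    by rewrite gauss_pdfE.
(* The normalisation is read off from the law of the first sample, which is available because [k] is
   positive. *)
have kappa1 : (\int[lebesgue_Rn R d]_x (kappa * gker Sigma mu 1 x)%:E = 1)%E.
  have := XD true 0%N k0 setT measurableT.
  rewrite preimage_setT probability_setT => ->.
  by apply: eq_integral => x _; rewrite indicT mul1r.
pose theta b i w := tuple_of_cV (sgd_theta eta theta0 v X b i w).
pose m0 (b : bool) := theta0 - e *: (theta0 - (if b then v else - v)).
have thetaO b w : theta b 0%N w = tuple_of_cV (m0 b) by [].
have thetaS b i w : theta b i.+1 w = sgd_step c e (theta b i w, X b i w).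
  rewrite -[RHS]vec_ofK; congr tuple_of_cV.
  rewrite /sgd_step vec_of_affine tuple_of_cVK /theta tuple_of_cVK /= /e /c.
  by apply/matrixP => r l; rewrite !mxE; ring.
have K b := sgd_density Spd kappa0 kappa1 e0 (mX b) (XD b) (thetaO b) (thetaS b)
  (independent_slice indep b).
have [k' kE] : exists k', k = k'.+1 by exists k.-1; rewrite prednK.
have k'k : (k' < k)%N by rewrite kE.
have [K1 K10 H1] := K true k' k'k.
have [K2 K20 H2] := K false k' k'k.
rewrite -kE !tuple_of_cVK in H1 H2.
have s0 : 0 < sgd_scale c e k by rewrite kE sgd_scaleS_gt0.
have P1 b : P (theta b k @^-1` setT) = 1%E by rewrite preimage_setT probability_setT.
rewrite (renyi_div_gauss Spd kappa0 kappa1 s0 alpha1 K10 K20 (P1 true) (P1 false)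
  pE qE H1 H2).
rewrite lee_fin sgd_meanB.
(* The initial means are [c theta0 + e v] and [c theta0 - e v]. *)
have -> : m0 true - m0 false = (2 * e) *: v.
  by rewrite /m0; apply/matrixP => i j; rewrite !mxE; ring.
rewrite scalerA mahalZ -/(mahal Sigma v) mulrA.
apply: ler_wpM2r; first exact: mahal_ge0.
(* After cancellation the claim is [k e^2 c^(2k) <= s_k], which is [lb]. *)
have lb := sgd_scale_lb e k c1.
have kR : 0 < k%:R :> R by rewrite ltr0n.
have ck : 0 < c ^+ k by rewrite exprn_gt0.
rewrite mulrAC ler_pdivrMr ?mulr_gt0//.
have -> : 2 * alpha / k%:R * (2 * sgd_scale c e k) =
    alpha * (4 / k%:R * sgd_scale c e k) by field; rewrite gt_eqF.
rewrite ler_wpM2l ?(le_trans ler01 (ltW alpha1))//.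
rewrite mulrAC ler_pdivlMr//.
rewrite mulnC exprM in lb.
move: lb; move: (sgd_scale _ _ _) (c ^+ k) => s ck'.
by move=> lb; rewrite exprMn; lra.
Qed.
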